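(* Let $m\geq 3$ be an odd integer and let $D_{2m}=\langle a,b\mid a^m=b^2=1,\ b^{-1}ab=a^{-1}\rangle$ be the dihedral group of order $2m$. Then $$m(D_{2m})=m^2.$$ Moreover, $\mathcal{CD}(D_{2m})$ is a chain of length $0$, namely $$\mathcal{CD}(D_{2m})=\{\langle a\rangle\}.$$
   Context: For a finite group $G$ and a subgroup $H\leq G$, the Chermak-Delgado measure of $H$ is $m_G(H)=|H|\,|C_G(H)|$, where $C_G(H)$ is the centralizer of $H$ in $G$. Set $m(G)=\max\{m_G(H)\mid H\leq G\}$ and $\mathcal{CD}(G)=\{H\leq G\mid m_G(H)=m(G)\}$; this set is a sublattice of the subgroup lattice of $G$, called the Chermak-Delgado lattice of $G$. A chain of length $0$ is a lattice with exactly one element. (The integer $m$ is not to be confused with the function $m(\cdot)$ on groups.) *)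

(* Defs.v *)
From mathcomp Require Import all_boot all_fingroup.

Set Implicit Arguments.
Unset Strict Implicit.
Unset Printing Implicit Defensive.

Local Open Scope group_scope.

Definition cd_measure (gT : finGroupType) (G H : {group gT}) : nat :=
  (#|H| * #|'C_G(H)|)%N.

Definition cd_max (gT : finGroupType) (G : {group gT}) : nat :=
  \max_(H : {group gT} | H \subset G) cd_measure G H.

Definition cd_lattice (gT : finGroupType) (G : {group gT}) :
    {set {group gT}} :=
  [set H : {group gT} | (H \subset G) && (cd_measure G H == cd_max G)].

(* G = < a, b | a^m = b^2 = 1, b^-1 a b = a^-1 >. The isomorphism with the    *)
(* presented group says that no other relations hold; the remaining clauses   *)
(* say that a and b are generators of G satisfying the relations. As G is     *)
(* finite, the epimorphism from the presented group onto G sending its        *)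
(* generators to a and b is then an isomorphism.                              *)
Definition dihedral_presentation (gT : finGroupType) (m : nat)
    (G : {group gT}) (a b : gT) : Prop :=
  [/\ G :=: <<[set a; b]>>, a ^+ m = 1, b ^+ 2 = 1, a ^ b = a^-1
    & G \isog Grp (x : y : x ^+ m, y ^+ 2, x ^ y = x^-1)].

(* Main.v *)
Require Import Defs.
From mathcomp Require Import all_boot all_fingroup all_solvable.

(** The rotation subgroup [A = <[a]>] is abelian of index 2, and as [m] is odd no
    nontrivial element of [A] commutes with an element outside [A].  For [H <= G]
    with centralizer [C]: if [1 < H <= A], then [C = A] and the measure is
    [#|H| * m]; if [H = 1], or if [C <= A] but not [H <= A] (so that [C = 1]), the
    measure is at most [2 * m]; if neither is in [A], then both meet [A] trivially,
    so both have order at most 2. *)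

Local Open Scope group_scope.

(** Any [r] in [K] outside [A] centralizes [H], so [H :&: A] lies in ['C_A[r] = 1]. *)
Lemma centralizing_TI (gT : finGroupType) (G A H K : {group gT}) :
  {in G :\: A, forall r, 'C_A[r] = 1} -> K \subset G -> ~~ (K \subset A) ->
  K \subset 'C(H) -> H :&: A = 1.
Proof.
move=> semiA sKG /subsetPn[r rK rA] cHK; apply/trivgP.
have <- : 'C_A[r] = 1 by rewrite semiA // inE rA (subsetP sKG).
by rewrite /= (setIC H) setIS // sub_cent1 (subsetP cHK).
Qed.

(** The [?= iff] form yields both the maximum and the uniqueness of the subgroup attaining it. *)
Lemma cd_measure_leqif_abelian2 (gT : finGroupType) (G A H : {group gT}) :
  abelian A -> 2 < #|A| -> A \subset G -> #|G| = (2 * #|A|)%N ->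
  {in G :\: A, forall r, 'C_A[r] = 1} -> H \subset G ->
  cd_measure G H <= #|A| ^ 2 ?= iff (H == A).
Proof.
move=> abA A_gt2 sAG oG semiA sHG; apply/leqifP; rewrite /cd_measure -mulnn.
pose C := 'C_G(H)%G.
have sCG : C \subset G by apply: subsetIl.
have cHC : C \subset 'C(H) by apply: subsetIr.
(* The product [K * A] has [#|K| * #|A|] elements and lies in [G], of order [2 * #|A|]. *)
have TI_le2 (K : {group gT}) : K \subset G -> K :&: A = 1 -> #|K| <= 2.
  move=> sKG tiKA; rewrite -(leq_pmul2r (cardG_gt0 A)) -oG -TI_cardMg //.
  by rewrite subset_leq_card // mul_subG.
have lt2A : 2 * #|A| < #|A| * #|A| by rewrite ltn_pmul2r ?cardG_gt0.
have [sHA | nsHA] := boolP (H \subset A); last first.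
  have -> : (H == A) = false by apply: contraNF nsHA => /eqP->.
  have tiCA : C :&: A = 1.
    by apply: centralizing_TI semiA sHG nsHA _; rewrite centsC.
  have [sCA | nsCA] := boolP (C \subset A).
    have C1 : 'C_G(H) = 1 by rewrite -tiCA; apply/esym/setIidPl.
    rewrite C1 cards1 muln1.
    by rewrite (leq_ltn_trans _ lt2A) // -oG subset_leq_card.
  have tiHA : H :&: A = 1 by apply: centralizing_TI semiA sCG nsCA cHC.
  (* Both orders are at most 2; bounding that of [C] by [#|A|] instead allows [lt2A] to conclude. *)
  apply: leq_ltn_trans lt2A.
  by rewrite leq_mul ?TI_le2 // (leq_trans (TI_le2 C sCG tiCA)) // ltnW.
have sAC : A \subset C by rewrite subsetI sAG (sub_abelian_cent2 abA).
have [H1 | ntH] := eqVneq (H : {set gT}) 1.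
  have -> : (H == A) = false.
    by apply: contraTF A_gt2 => /eqP <-; rewrite H1 cards1.
  rewrite H1 cards1 mul1n (leq_ltn_trans _ lt2A) // -oG.
  by rewrite subset_leq_card ?subsetIl.
(* If [C] left [A], then [H = H :&: A] would be trivial. *)
have CA : 'C_G(H) = A.
  apply/eqP; rewrite eqEsubset sAC andbT; apply: contraR ntH => nsCA.
  by rewrite -(centralizing_TI _ _ _ _ _ semiA sCG nsCA cHC) eq_sym; apply/eqP/setIidPl.
rewrite CA -val_eqE /=.
case: eqP => [-> // | /eqP neHA].
by rewrite ltn_pmul2r ?cardG_gt0 // proper_card // properEneq neHA.
Qed.

(** [G] and ['D_(2 * m)] have the same presentation, hence are isomorphic. *)
Lemma dihedral_presentation_card (m : nat) (gT : finGroupType)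
    (G : {group gT}) (a b : gT) :
  1 < m -> dihedral_presentation m G a b -> #|G| = (2 * m)%N.
Proof.
move=> m_gt1 [_ _ _ _ isoG].
have isoD : 'D_(2 * m) \isog Grp (x : y : x ^+ m, y ^+ 2, x ^ y = x^-1).
  by rewrite mul2n; apply: Grp_dihedral.
have /(isoGrpP _ isoD)[-> _] : G \isog 'D_(2 * m).
  by rewrite isogEhom isoD isoGrp_hom //= isoG isoGrp_hom.
by rewrite mul2n card_dihedral.
Qed.

Lemma dihedral_presentation_mul (m : nat) (gT : finGroupType)
    (G : {group gT}) (a b : gT) :
  dihedral_presentation m G a b -> G :=: <[a]> * <[b]>.
Proof.
case=> -> _ _ ab _; rewrite -norm_joinEr ?joing_idl ?joing_idr //.
by rewrite norms_cycle ab groupV cycle_id.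
Qed.

(** The relation [a ^+ m = 1] gives [#[a] <= m]; conversely [2 * m = #|G| <= #[a] * #[b] <= #[a] *
    2]. *)
Lemma dihedral_presentation_order (m : nat) (gT : finGroupType)
    (G : {group gT}) (a b : gT) :
  1 < m -> dihedral_presentation m G a b -> #[a] = m.
Proof.
move=> m_gt1 dG; have oG := dihedral_presentation_card _ _ _ _ _ m_gt1 dG.
have defG := dihedral_presentation_mul _ _ _ _ _ dG.
have [_ am b2 _ _] := dG.
have m_gt0 : 0 < m by apply: ltnW.
apply/eqP; rewrite eqn_leq dvdn_leq ?order_dvdn ?am //=.
rewrite -(leq_pmul2l (isT : 0 < 2)) -oG defG mulnC.
have ob : #[b] <= 2 by rewrite dvdn_leq // order_dvdn b2.
rewrite -[#[a]]/#|<[a]>| (leq_trans _ (leq_mul (leqnn _) ob)) //.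
by rewrite mul_cardG leq_pmulr ?cardG_gt0.
Qed.

(** An element outside [<[a]>] inverts [<[a]>], so any [x] there commuting with it has [x ^+ 2 = 1];
    as [x ^+ m = 1] with [m] odd, [x = 1]. *)
Lemma dihedral_presentation_semiregular (m : nat) (gT : finGroupType)
    (G : {group gT}) (a b : gT) :
  odd m -> dihedral_presentation m G a b ->
  {in G :\: <[a]>, forall r, 'C_(<[a]>)[r] = 1}.
Proof.
move=> m_odd dG r; have defG := dihedral_presentation_mul _ _ _ _ _ dG.
have [_ am b2 ab _] := dG.
rewrite inE defG => /andP[rA /mulsgP[u v uA vB def_r]].
(* An even power of [b] is trivial and would put [r] in [<[a]>]. *)
have vb : v = b.
  case/cycleP: vB => i def_v; move: rA; rewrite def_r def_v -(expg_mod i b2) modn2.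
  by case: (odd i) => //=; rewrite mulg1 uA.
apply/trivgP/subsetP=> x /setIP[xA /cent1P xr]; rewrite inE.
have xV : x ^ r = x^-1.
  rewrite def_r vb conjgM.
  have -> : x ^ u = x.
    by apply/conjg_fixP/commgP; case/cycleP: xA => i ->; case/cycleP: uA => j ->;
      apply/commuteX2.
  by case/cycleP: xA => i ->; rewrite conjXg ab expgVn.
have x2 : x ^+ 2 = 1.
  by apply/eqP; rewrite expgS expg1 -eq_invg_mul -xV conjgE xr mulKg.
have xm : x ^+ m = 1.
  by case/cycleP: xA => i ->; rewrite -expgM mulnC expgM am expg1n.
have : coprime 2 m by rewrite coprime2n.
rewrite -order_eq1 -dvdn1 => /eqP <-.
by rewrite dvdn_gcd !order_dvdn x2 xm !eqxx.
Qed.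

Theorem corollary2 (m : nat) (gT : finGroupType) (G : {group gT}) (a b : gT) :
  3 <= m -> odd m -> dihedral_presentation m G a b ->
  [/\ cd_max G = (m ^ 2)%N,
      #|cd_lattice G| = 1%N
    & cd_lattice G = [set <[a]>%G]].
Proof.
move=> m_ge3 m_odd dG; have m_gt1 : 1 < m by apply: ltnW.
have oa := dihedral_presentation_order _ _ _ _ _ m_gt1 dG.
have sAG : <[a]>%G \subset G.
  by rewrite (dihedral_presentation_mul _ _ _ _ _ dG) mulG_subl.
have bound (H : {group gT}) :
    H \subset G -> cd_measure G H <= m ^ 2 ?= iff (H == <[a]>%G).
  rewrite -oa; apply: cd_measure_leqif_abelian2 => //; first exact: cycle_abelian.
  - by rewrite [#|_|]oa.
  - by rewrite [#|<[a]>%G|]oa; apply: dihedral_presentation_card dG.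
  - exact: dihedral_presentation_semiregular dG.
have maxG : cd_max G = (m ^ 2)%N.
  apply/eqP; rewrite eqn_leq; apply/andP; split.
    by apply/bigmax_leqP=> H /bound[].
  (* The equality case of the bound at [<[a]>] shows that [m ^ 2] is attained. *)
  have [_] := bound _ sAG; rewrite eqxx => /eqP <-.
  by rewrite /cd_max; apply: (leq_bigmax_cond (F := cd_measure G)).
have defL : cd_lattice G = [set <[a]>%G].
  apply/setP=> H; rewrite !inE maxG.
  have [/bound[_ ->] // | nsHG] := boolP (H \subset G).
  by apply/esym; apply: contraNF nsHG => /eqP->.
by split; rewrite // defL cards1.
Qed.
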